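(* Let $n\in\mathbb N$ and let $S$ be the generalized Sobrero algebra. For $f\in\Omega$ and $\widehat\omega=\delta+\widehat\varepsilon+\widehat j\,\omega$ ($\delta,\omega\in\mathbb R$, with $\delta$ larger than the exponential growth rates of the functions involved), let $$\widehat{\mathcal L}f(\widehat\omega)=\int_0^{\infty}f(t)e^{-\widehat\omega t}\,dt\in S .$$ Then $\widehat{\mathcal L}$ is an $\mathbb R$-linear mapping and has the properties $$\widehat{\mathcal L}(f^{(k)})=\widehat\omega^{\,k}\,\widehat{\mathcal L}f-\sum_{p=0}^{k-1}\widehat\omega^{\,k-1-p}f^{(p)}(0),\qquad k\in\mathbb N,$$ $$\widehat{\mathcal L}(f*g)=\widehat{\mathcal L}f\cdot\widehat{\mathcal L}g ,$$ where, in the first relation, $f$ is $k$ times differentiable on $[0,\infty)$ with $f,f',\ldots,f^{(k)}\in\Omega$, and in the second $f,g\in\Omega$.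
   Context: The generalized Sobrero algebra $S$ is the commutative, associative, unital real algebra of dimension $2(n+1)$ with basis $\{\widehat\varepsilon^{\,k},\widehat j\,\widehat\varepsilon^{\,k}\}_{k=0}^{n}$, where $\widehat j^{\,2}=-1$, $\widehat\varepsilon^{\,n+1}=0$, $\widehat\varepsilon^{\,n}\neq0$, and $\widehat\varepsilon^{\,0}=1$ is the unit; i.e. $S\cong\mathbb C[\widehat\varepsilon]/(\widehat\varepsilon^{\,n+1})$. The exponential is given by the usual power series and integrals are taken componentwise. $\Omega$ is the space of locally integrable, piecewise continuous functions $f:\mathbb R\to\mathbb R$ with support in $[0,+\infty)$ and of at most exponential growth, $|f(t)|\le Me^{at}$ for some constants $M,a$ (depending on $f$). The derivatives $f^{(p)}$ are derivatives on $[0,\infty)$ (one-sided at $0$), extended by $0$ to $t<0$; $(f*g)(t)=\int_0^tf(\tau)g(t-\tau)\,d\tau$. *)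

(* Defs.v *)
From HB Require Import structures.
From mathcomp Require Import all_boot all_order all_algebra all_field.
From mathcomp Require Import all_classical all_reals all_analysis.
Set Implicit Arguments.
Unset Strict Implicit.
Unset Printing Implicit Defensive.
Import Order.TTheory GRing.Theory Num.Theory numFieldNormedType.Exports.
Local Open Scope classical_set_scope.
Local Open Scope ring_scope.

(* The basis 1, e, ..., e^n, j, j e, ..., j e^n, in this order. *)
Definition sobrero_basis (R : realType) (n : nat) (S : falgType R) (j e : S)
    : (n.+1 + n.+1).-tuple S :=
  [tuple of [tuple e ^+ (k : nat) | k < n.+1] ++
            [tuple j * e ^+ (k : nat) | k < n.+1]].

(* The generalized Sobrero algebra is given by its presentation, which
   determines it up to a unique isomorphism preserving j and e. Commutativity
   is stated separately because a falgType is only associative and unital. *)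
Record is_sobrero (R : realType) (n : nat) (S : falgType R) (j e : S) : Prop :=
  IsSobrero {
    sobrero_mulC : forall x y : S, x * y = y * x;
    sobrero_j2 : j ^+ 2 = - 1;
    sobrero_eps_nilp : e ^+ n.+1 = 0;
    sobrero_eps_neq0 : e ^+ n != 0;
    sobrero_basisP : basis_of {:S}%VS (sobrero_basis n j e) }.

Definition cw_lim (R : realType) (S : falgType R) (m : nat) (X : m.-tuple S)
    (u : nat -> S) : S :=
  \sum_(i < m) limn (fun N : nat => coord X i (u N)) *: X`_i.

Definition cw_integrable (R : realType) (S : falgType R) (m : nat)
    (X : m.-tuple S) (D : set R) (F : R -> S) : Prop :=
  forall i : 'I_m,
    (@lebesgue_measure R).-integrable D (fun t => (coord X i (F t))%:E).

Definition cw_integral (R : realType) (S : falgType R) (m : nat)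
    (X : m.-tuple S) (D : set R) (F : R -> S) : S :=
  \sum_(i < m)
    (\int[@lebesgue_measure R]_(t in D) coord X i (F t))%R *: X`_i.

Definition cw_exp (R : realType) (S : falgType R) (m : nat) (X : m.-tuple S)
    (x : S) : S :=
  cw_lim X (fun N : nat => \sum_(0 <= p < N) (p`!%:R)^-1 *: x ^+ p).

Definition laplace_integrand (R : realType) (n : nat) (S : falgType R)
    (j e : S) (f : R -> R) (w : S) (t : R) : S :=
  f t *: cw_exp (sobrero_basis n j e) (- (t *: w)).

Definition laplace_converges (R : realType) (n : nat) (S : falgType R)
    (j e : S) (f : R -> R) (w : S) : Prop :=
  cw_integrable (sobrero_basis n j e) `[0, +oo[%classic
    (laplace_integrand n j e f w).

Definition laplace (R : realType) (n : nat) (S : falgType R)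
    (j e : S) (f : R -> R) (w : S) : S :=
  cw_integral (sobrero_basis n j e) `[0, +oo[%classic
    (laplace_integrand n j e f w).

(* Finitely many discontinuities in each bounded interval, with finite
   one-sided limits everywhere. *)
Definition piecewise_continuous (R : realType) (f : R -> R) : Prop :=
  (forall a b : R,
     finite_set [set t | t \in `[a, b] /\ ~ {for t, continuous f}]) /\
  (forall t : R, cvg (f x @[x --> t^'-]) /\ cvg (f x @[x --> t^'+])).

Definition exp_growth (R : realType) (f : R -> R) (a : R) : Prop :=
  exists M : R, forall t : R, `|f t| <= M * expR (a * t).

Definition Omega (R : realType) (f : R -> R) : Prop :=
  [/\ locally_integrable setT f,
      piecewise_continuous f,
      (forall t : R, t < 0 -> f t = 0) &
      exists a : R, exp_growth f a].

(* The growth rate of f is the infimum of the admissible exponents a, so it is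
   smaller than d exactly when some admissible exponent is. *)
Definition Omega_lt (R : realType) (d : R) (f : R -> R) : Prop :=
  Omega f /\ exists2 a : R, a < d & exp_growth f a.

(* Derivative at t of the restriction of f to [0, +oo[: one-sided at 0,
   ordinary at t > 0. *)
Definition diff_quotient_nneg (R : realType) (f : R -> R) (t : R) :=
  (f (t + h) - f t) / h @[h --> within [set h : R | 0 <= t + h] 0^'].

Definition derivable_nneg (R : realType) (f : R -> R) : Prop :=
  forall t : R, 0 <= t -> cvg (diff_quotient_nneg f t).

Definition derive_nneg (R : realType) (f : R -> R) (t : R) : R :=
  if 0 <= t then lim (diff_quotient_nneg f t) else 0.

Definition derive_nnegn (R : realType) (p : nat) (f : R -> R) : R -> R :=
  iter p (@derive_nneg R) f.

Definition derivable_nnegn (R : realType) (k : nat) (f : R -> R) : Prop :=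
  forall p : nat, (p < k)%N -> derivable_nneg (derive_nnegn p f).

Definition convolution (R : realType) (f g : R -> R) (t : R) : R :=
  (\int[@lebesgue_measure R]_(tau in `[0, t]%classic)
     (f tau * g (t - tau)))%R.

(* Main.v *)
Require Import Defs.
From HB Require Import structures.
From mathcomp Require Import all_boot all_order all_algebra all_field.
From mathcomp Require Import all_classical all_reals all_analysis.
From mathcomp Require Import measurable_realfun.
Set Implicit Arguments.
Unset Strict Implicit.
Unset Printing Implicit Defensive.
Import Order.TTheory GRing.Theory Num.Theory numFieldNormedType.Exports.
Local Open Scope classical_set_scope.
Local Open Scope ring_scope.

(** Everything rests on three properties of the coordinates of the exponential
    [E t = exp (- t w)]: it satisfies [E' = - w E] with [E 0 = 1], it is
    multiplicative, [E (s + t) = E s * E t], and for every [b > - delta] its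
    coordinates are [O (exp (b t))] on the half-line.

    The differential equation comes from termwise differentiation of the
    exponential series ([cw_exp_solves]).  Solutions of a linear equation
    [K' = x K] in a commutative algebra are determined by [K 0]
    ([solves_unique]).  This yields multiplicativity ([solvesD]) and also
    identifies [E t] with the product of [exp (- delta t)], of the polynomial
    [sum_k (- t e) ^ k / k!] and of [cos (omega t) - j sin (omega t)], because
    the product solves the same equation; the growth bound can be read off
    that product ([sobrero_exp_growth]).

    A function of growth rate less than [delta] thus becomes exponentially
    decaying when multiplied by a coordinate of [E], which makes the transform
    converge; linearity is then that of the integral.  Multiplication by a
    fixed element of the algebra commutes with the coordinatewise integral
    ([coord_cw_integral_mul]), so that identities in the algebra reduce to
    identities between real integrals, one for each coordinate.

    For the derivative, [(g E)' = g' E - w g E] is integrated over the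
    half-line ([laplace_derive]), and an induction gives the formula for all
    orders.  The fundamental theorem of calculus requires [g'] to be
    continuous: since [g'] is a derivative that has one-sided limits, it is
    ([derive_nneg_right_continuous], [derive_nneg_left_continuous]).

    For the convolution, Fubini's theorem is applied to the kernel
    [f tau * g (t - tau) * E t], which equals
    [f tau * E tau * (g (t - tau) * E (t - tau))]; one order of integration
    gives the transform of the convolution, the other one the product of the
    transforms, by invariance of the Lebesgue measure under translation
    ([conv_kernel_integral1], [conv_kernel_integral2]). *)

(** * Coordinates in a finite-dimensional algebra *)

Section Coordinates.
Context (R : realType) (S : falgType R) (m : nat) (X : m.-tuple S).
Context (basisX : basis_of {:S}%VS X).

Lemma coordE (z : S) : z = \sum_(i < m) coord X i z *: X`_i.
Proof. exact: coord_basis basisX (memvf z). Qed.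

Lemma coord_ext (y z : S) : (forall i, coord X i y = coord X i z) -> y = z.
Proof. by move=> yz; rewrite (coordE y) (coordE z); apply: eq_bigr => i _; rewrite yz. Qed.

Lemma coord_sumX (a : 'I_m -> R) i : coord X i (\sum_(k < m) a k *: X`_k) = a i.
Proof. by rewrite coord_sum_free// (basis_free basisX). Qed.

Lemma coord_mulE i (y z : S) :
  coord X i (y * z) = \sum_(k < m) coord X k z * coord X i (y * X`_k).
Proof.
rewrite {1}(coordE z) mulr_sumr linear_sum.
by apply: eq_bigr => k _; rewrite -scalerAr linearZ.
Qed.

Lemma coord_mul2E i (y z : S) :
  coord X i (y * z) = \sum_(k < m) coord X k z *
    \sum_(l < m) coord X l y * coord X i (X`_l * X`_k).
Proof.
rewrite coord_mulE; apply: eq_bigr => k _; congr (_ * _).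
rewrite {1}(coordE y) mulr_suml linear_sum.
by apply: eq_bigr => l _; rewrite -scalerAl linearZ.
Qed.

End Coordinates.

(** * Coordinatewise differentiation and linear differential equations *)

Section Derivatives.
Context (R : realType) (S : falgType R) (m : nat) (X : m.-tuple S).

Definition cw_derive (F : R -> S) (t : R) (D : S) : Prop :=
  forall i, is_derive t (1 : R) (fun s => coord X i (F s)) (coord X i D).

Lemma cw_derive_cst (y : S) t : cw_derive (fun=> y) t 0.
Proof. by move=> i; rewrite linear0; exact: is_derive_cst. Qed.

Lemma cw_derive_eq F t (D D' : S) : cw_derive F t D -> D = D' -> cw_derive F t D'.
Proof. by move=> ? <-. Qed.

Lemma cw_deriveZ (r : R -> R) F t (dr : R) (D : S) :
  is_derive t (1 : R) r dr -> cw_derive F t D ->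
  cw_derive (fun s => r s *: F s) t (r t *: D + dr *: F t).
Proof.
move=> hr hF i.
have -> : (fun s => coord X i (r s *: F s)) = r * (fun s => coord X i (F s)).
  by apply/funext => s; rewrite linearZ.
have hFi := hF i.
apply: is_derive_eq; rewrite linearD !linearZ/=.
by congr (_ + _); rewrite /GRing.scale/= mulrC.
Qed.

Lemma cw_deriveD F G t (D E : S) : cw_derive F t D -> cw_derive G t E ->
  cw_derive (fun s => F s + G s) t (D + E).
Proof.
move=> hF hG i; have hFi := hF i; have hGi := hG i; rewrite linearD.
have -> : (fun s => coord X i (F s + G s)) =
          (fun s => coord X i (F s)) + (fun s => coord X i (G s)).
  by apply/funext => s; rewrite linearD.
exact: is_deriveD.
Qed.

Lemma cw_derive_sum n (F : 'I_n -> R -> S) t (D : 'I_n -> S) :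
  (forall k, cw_derive (F k) t (D k)) ->
  cw_derive (fun s => \sum_(k < n) F k s) t (\sum_(k < n) D k).
Proof.
move=> hF i; rewrite linear_sum.
have -> : (fun s => coord X i (\sum_(k < n) F k s)) =
          \sum_(k < n) (fun s => coord X i (F k s)).
  by apply/funext => s; rewrite linear_sum fct_sumE.
by apply: is_derive_sum => k; exact: hF.
Qed.

Lemma cw_derive_comp_affine F (a b t : R) (D : S) :
  cw_derive F (a * t + b) D -> cw_derive (fun s => F (a * s + b)) t (a *: D).
Proof.
move=> hF i; rewrite linearZ/= mulrC.
have hl : is_derive t (1 : R) (fun s => a * s + b) a.
  have -> : (fun s => a * s + b) = a \*: id + cst b by [].
  by apply: is_derive_eq; rewrite addr0 /GRing.scale/= mulr1.
exact: (@is_derive1_comp _ (fun s => coord X i (F s)) (fun s => a * s + b)).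
Qed.

Context (basisX : basis_of {:S}%VS X).

Lemma cw_deriveM F G t (D E : S) : cw_derive F t D -> cw_derive G t E ->
  cw_derive (fun s => F s * G s) t (D * G t + F t * E).
Proof.
move=> hF hG i.
have -> : (fun s => coord X i (F s * G s)) =
  \sum_(k < m) ((fun s => coord X k (G s)) * \sum_(l < m)
    (coord X i (X`_l * X`_k) \*: (fun s => coord X l (F s)))).
  apply/funext => s; rewrite coord_mul2E// fct_sumE.
  apply: eq_bigr => k _; rewrite /= fct_sumE; congr (_ * _).
  by apply: eq_bigr => l _; rewrite mulrC.
have hFi l := hF l; have hGk k := hG k.
apply: is_derive_eq.
rewrite linearD/= !coord_mul2E// -big_split/=.
apply: eq_bigr => k _; rewrite fct_sumE; congr (_ + _).
  by congr (_ * _); apply: eq_bigr => l _; rewrite mulrC.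
by rewrite /GRing.scale/= mulrC; congr (_ * _); apply: eq_bigr => l _; rewrite mulrC.
Qed.

Lemma cw_derive0_cst F s t : (forall u, cw_derive F u 0) -> F s = F t.
Proof.
move=> hF; apply: (coord_ext basisX) => i.
apply: (@is_derive_0_is_cst _ (fun u => coord X i (F u))) => u.
by have := hF u i; rewrite linear0.
Qed.

(** The linear differential equation [K' = x K]. *)
Definition solves (x : S) (K : R -> S) : Prop := forall t, cw_derive K t (x * K t).

Context (mulC : forall y z : S, y * z = z * y).

(** The product is constant because the derivatives of the two factors are
    opposite multiples of the product itself. *)
Lemma solves_mul_reflect x K G t : solves x K -> solves x G ->
  K t * G (- t) = K 0 * G 0.
Proof.
move=> hK hG.
have -> : G 0 = G (- 0) by rewrite oppr0.
apply: (@cw_derive0_cst (fun s => K s * G (- s))) => u.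
have hGN : cw_derive (fun s => G (- s)) u (- (x * G (- u))).
  have := @cw_derive_comp_affine G (- 1) 0 u (x * G (- u)).
  rewrite !mulN1r addr0 scaleN1r.
  have -> : (fun s => G (-1 * s + 0)) = (fun s => G (- s)).
    by apply/funext => s; rewrite mulN1r addr0.
  by apply; exact: hG.
apply: cw_derive_eq; first exact: cw_deriveM (hK u) hGN.
by rewrite mulrN mulrA (mulC (K u) x) subrr.
Qed.

(** Variation of constants: a solution with value 1 at the origin is
    invertible, with inverse its own reflection, so it generates all others. *)
Lemma solves_unique x K G t : solves x K -> solves x G -> G 0 = 1 ->
  K t = K 0 * G t.
Proof.
move=> hK hG G0.
have GG : G t * G (- t) = 1 by rewrite (solves_mul_reflect t hG hG) G0 mulr1.
have KG : K t * G (- t) = K 0 by rewrite (solves_mul_reflect t hK hG) G0 mulr1.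
by rewrite -KG -mulrA (mulC (G (- t))) GG mulr1.
Qed.

Lemma solvesM x y K G : solves x K -> solves y G ->
  solves (x + y) (fun t => K t * G t).
Proof.
move=> hK hG t; apply: cw_derive_eq; first exact: cw_deriveM.
by rewrite mulrDl !mulrA (mulC (K t) y).
Qed.

(** Both sides, as functions of [t], solve the equation with initial value
    [G s]. *)
Lemma solvesD x G s t : solves x G -> G 0 = 1 -> G (s + t) = G s * G t.
Proof.
move=> hG G0.
have := @solves_unique x (fun u => G (1 * u + s)) G t.
rewrite mul1r mulr0 add0r addrC => -> // u.
have := @cw_derive_comp_affine G 1 s u _ (hG _).
by rewrite scale1r.
Qed.

End Derivatives.

(** * The exponential series *)

Section Exponential.
Context (R : realType) (S : falgType R) (m : nat) (X : m.-tuple S).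
Context (basisX : basis_of {:S}%VS X).

Definition l1norm (z : S) : R := \sum_(k < m) `|coord X k z|.

Lemma l1norm_mul_le (y z : S) :
  l1norm (y * z) <= (\sum_(k < m) l1norm (y * X`_k)) * l1norm z.
Proof.
rewrite {1}/l1norm.
apply: (@le_trans _ _ (\sum_(k < m) `|coord X k z| * l1norm (y * X`_k))).
  under [leRHS]eq_bigr do rewrite mulr_sumr.
  rewrite [leRHS]exchange_big/=; apply: ler_sum => i _.
  rewrite coord_mulE//; apply: le_trans (ler_norm_sum _ _ _) _.
  by apply: ler_sum => k _; rewrite normrM.
rewrite {2}/l1norm mulr_sumr; apply: ler_sum => k _; rewrite mulrC.
apply: ler_wpM2r => //; rewrite (bigD1 k)//= lerDl.
by apply: sumr_ge0 => l _; apply: sumr_ge0.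
Qed.

(** Left multiplication by [x] is a bounded operator for [l1norm], so the
    powers of [x] grow at most geometrically. *)
Lemma coord_pow_le (x y : S) i : exists C K : R, [/\ 0 <= C, 0 <= K &
  forall p, `|coord X i (y * x ^+ p)| <= C * K ^+ p].
Proof.
have sum_ge0 (z : S) : 0 <= \sum_(k < m) l1norm (z * X`_k).
  by apply: sumr_ge0 => k _; apply: sumr_ge0.
pose K := \sum_(k < m) l1norm (x * X`_k); pose Ky := \sum_(k < m) l1norm (y * X`_k).
exists (Ky * l1norm 1), K; split => [||p].
- by rewrite mulr_ge0 ?sum_ge0//; exact: sumr_ge0.
- exact: sum_ge0.
have powK : l1norm (x ^+ p) <= K ^+ p * l1norm 1.
  elim: p => [|p IHp]; first by rewrite !expr0 mul1r.
  rewrite exprS; apply: le_trans (l1norm_mul_le _ _) _.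
  by rewrite exprS -mulrA; apply: ler_wpM2l => //; exact: sum_ge0.
apply: (@le_trans _ _ (l1norm (y * x ^+ p))).
  by rewrite /l1norm (bigD1 i)//= lerDl; exact: sumr_ge0.
apply: le_trans (l1norm_mul_le _ _) _.
by rewrite -mulrA [l1norm 1 * _]mulrC; apply: ler_wpM2l => //; exact: sum_ge0.
Qed.

(** The extra factor [y] makes this family of power series stable under
    termwise differentiation. *)
Definition exp_coord (x y : S) i : R^nat := fun p => coord X i (y * x ^+ p) / p`!%:R.

Lemma pseries_diffs_exp_coord x y i :
  pseries_diffs (exp_coord x y i) = exp_coord x (y * x) i.
Proof.
apply/funext => p; rewrite /pseries_diffs /exp_coord exprS mulrA factS natrM invfM.
by rewrite mulrCA mulVKf.
Qed.

Lemma is_cvg_exp_coord x y i t : cvgn (pseries (exp_coord x y i) t).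
Proof.
have [C [K [C0 K0 CK]]] := coord_pow_le x y i.
apply: normed_cvg; rewrite /=.
apply: (@series_le_cvg _ _ (C *: exp_coeff (K * `|t|))) => [p|p|p|].
- exact: normr_ge0.
- by rewrite mulr_ge0// exp_coeff_ge0// mulr_ge0.
- rewrite /exp_coord/= !normrM normfV [`|_%:R|]ger0_norm// normrX.
  have -> : (C *: exp_coeff (K * `|t|)) p = C * K ^+ p / p`!%:R * `|t| ^+ p.
    by rewrite fctE /exp_coeff /= exprMn /GRing.scale/= !mulrA mulrAC.
  by apply: ler_wpM2r; [exact: exprn_ge0 | exact: ler_wpM2r].
- exact/is_cvg_seriesZ/is_cvg_series_exp_coeff.
Qed.

Lemma coord_exp_partial x y i t N :
  coord X i (y * \sum_(0 <= p < N) (p`!%:R)^-1 *: (t *: x) ^+ p) =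
  pseries (exp_coord x y i) t N.
Proof.
rewrite /pseries /series/= mulr_sumr linear_sum; apply: eq_bigr => p _.
by rewrite /exp_coord exprZn -!scalerAr !linearZ/= mulrA mulrC mulrA.
Qed.

(** The exponential is a coordinatewise limit; multiplication by [y] is linear
    in the coordinates and therefore commutes with the limit. *)
Lemma coord_cw_exp x y i t :
  coord X i (y * cw_exp X (t *: x)) = limn (pseries (exp_coord x y i) t).
Proof.
apply/esym/cvg_lim => //; rewrite coord_mulE//.
have -> : pseries (exp_coord x y i) t = fun N =>
    \sum_(k < m) pseries (exp_coord x 1 k) t N * coord X i (y * X`_k).
  apply/funext => N; rewrite -coord_exp_partial coord_mulE//.
  by apply: eq_bigr => k _; rewrite -coord_exp_partial mul1r.
apply: cvg_big => [|k _]; first by move=> [a b]; exact: add_continuous.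
apply: cvgMr_tmp.
rewrite /cw_exp /cw_lim coord_sumX//.
have -> : (fun N => coord X k (\sum_(0 <= p < N) p`!%:R^-1 *: (t *: x) ^+ p)) =
          pseries (exp_coord x 1 k) t.
  by apply/funext => N; rewrite -coord_exp_partial mul1r.
exact: is_cvg_exp_coord.
Qed.

Lemma cw_exp_solves x : solves X x (fun t => cw_exp X (t *: x)).
Proof.
move=> t i.
have -> : (fun s => coord X i (cw_exp X (s *: x))) =
          (fun s => limn (pseries (exp_coord x 1 i) s)).
  by apply/funext => s; rewrite -coord_cw_exp mul1r.
rewrite coord_cw_exp.
have -> : exp_coord x x i = pseries_diffs (exp_coord x 1 i).
  by rewrite pseries_diffs_exp_coord mul1r.
apply: (@pseries_snd_diffs _ _ (`|t| + 1)).
- exact: is_cvg_exp_coord.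
- by rewrite pseries_diffs_exp_coord; exact: is_cvg_exp_coord.
- by rewrite !pseries_diffs_exp_coord; exact: is_cvg_exp_coord.
- by rewrite [ltRHS]ger0_norm ?ltrDl// addr_ge0.
Qed.

Lemma cw_exp0 : cw_exp X 0 = 1.
Proof.
apply: (coord_ext basisX) => i; rewrite coord_sumX//.
apply: cvg_lim => //; apply: cvg_near_cst.
exists 1%N => // -[//|N] _; rewrite big_nat_recl// big1 ?addr0 => [|p _].
  by rewrite fact0 expr0 invr1 scale1r.
by rewrite expr0n scaler0.
Qed.

End Exponential.

(** * Exponential bounds on the half-line *)

Section Growth.
Context (R : realType).

(** Restricting the bound to [t >= 0] makes it monotone in the rate [b]. *)
Definition growth_nneg (r : R -> R) (b : R) : Prop :=
  exists2 C : R, 0 <= C & forall t, 0 <= t -> `|r t| <= C * expR (b * t).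

Lemma growth_nnegW (r : R -> R) a b : a <= b -> growth_nneg r a -> growth_nneg r b.
Proof.
move=> ab [C C0 rC]; exists C => // t t0; apply: le_trans (rC t t0) _.
by rewrite ler_wpM2l// ler_expR ler_wpM2r.
Qed.

Lemma growth_nnegD (r s : R -> R) b : growth_nneg r b -> growth_nneg s b ->
  growth_nneg (fun t => r t + s t) b.
Proof.
move=> [C C0 rC] [D D0 sD]; exists (C + D) => [|t t0]; first exact: addr_ge0.
by rewrite mulrDl; apply: le_trans (ler_normD _ _) _; rewrite lerD ?rC ?sD.
Qed.

Lemma growth_nnegM (r s : R -> R) a b : growth_nneg r a -> growth_nneg s b ->
  growth_nneg (fun t => r t * s t) (a + b).
Proof.
move=> [C C0 rC] [D D0 sD]; exists (C * D) => [|t t0]; first exact: mulr_ge0.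
by rewrite normrM mulrDl expRD mulrACA; apply: ler_pM => //; [exact: rC|exact: sD].
Qed.

Lemma growth_nneg_bounded (r : R -> R) C : (forall t, `|r t| <= C) -> growth_nneg r 0.
Proof.
move=> rC; exists C => [|t _]; first by apply: le_trans (rC 0).
by rewrite mul0r expR0 mulr1.
Qed.

Lemma growth_nneg_cst c : growth_nneg (fun=> c) 0.
Proof. exact: (@growth_nneg_bounded _ `|c|). Qed.

Lemma growth_nneg_sum n (r : 'I_n -> R -> R) b : 0 <= b ->
  (forall k, growth_nneg (r k) b) -> growth_nneg (fun t => \sum_(k < n) r k t) b.
Proof.
move=> b0; elim: n r => [|n IHn] r hr.
  under eq_fun do rewrite big_ord0.
  by apply: growth_nnegW (growth_nneg_cst 0).
under eq_fun do rewrite big_ord_recl.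
by apply: growth_nnegD; [exact: hr|apply: IHn => k; exact: hr].
Qed.

(** A consequence of [b t <= exp (b t)]. *)
Lemma growth_nneg_id b : 0 < b -> growth_nneg id b.
Proof.
move=> b0; exists b^-1 => [|t t0]; first by rewrite invr_ge0 ltW.
rewrite ger0_norm//= mulrC ler_pdivlMr// mulrC.
by apply: le_trans (expR_ge1Dx _); rewrite lerDr.
Qed.

Lemma growth_nneg_pow k b : 0 < b -> growth_nneg (fun t => t ^+ k) b.
Proof.
elim: k b => [|k IHk] b b0.
  under eq_fun do rewrite expr0.
  exact: growth_nnegW (ltW b0) (growth_nneg_cst 1).
under eq_fun do rewrite exprS.
have b20 : 0 < b / 2 by rewrite divr_gt0.
by rewrite (splitr b); apply: growth_nnegM; [exact: growth_nneg_id|exact: IHk].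
Qed.

Lemma growth_nneg_expR a : growth_nneg (fun t => expR (a * t)) a.
Proof. by exists 1 => // t _; rewrite mul1r ger0_norm ?expR_ge0. Qed.

End Growth.

Section CoordinateGrowth.
Context (R : realType) (S : falgType R) (m : nat) (X : m.-tuple S).
Context (basisX : basis_of {:S}%VS X).

Definition cw_growth (F : R -> S) (b : R) : Prop :=
  forall i, growth_nneg (fun t => coord X i (F t)) b.

Lemma cw_growth_cst y : cw_growth (fun=> y) 0.
Proof. by move=> i; exact: growth_nneg_cst. Qed.

Lemma cw_growthZ r F a b : growth_nneg r a -> cw_growth F b ->
  cw_growth (fun t => r t *: F t) (a + b).
Proof.
move=> hr hF i; under eq_fun do rewrite linearZ/=.
exact: growth_nnegM.
Qed.

Lemma cw_growthD F G b : cw_growth F b -> cw_growth G b ->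
  cw_growth (fun t => F t + G t) b.
Proof.
move=> hF hG i; under eq_fun do rewrite linearD/=.
apply: growth_nnegD; [exact: hF|exact: hG].
Qed.

Lemma cw_growth_sum n (F : 'I_n -> R -> S) b : 0 <= b ->
  (forall k, cw_growth (F k) b) -> cw_growth (fun t => \sum_(k < n) F k t) b.
Proof.
move=> b0 hF i; under eq_fun do rewrite linear_sum.
by apply: growth_nneg_sum => // k; exact: hF.
Qed.

Lemma cw_growthM F G a b : 0 <= a -> 0 <= b -> cw_growth F a -> cw_growth G b ->
  cw_growth (fun t => F t * G t) (a + b).
Proof.
move=> a0 b0 hF hG i; under eq_fun do rewrite coord_mul2E//.
apply: growth_nneg_sum => [|k]; first exact: addr_ge0.
rewrite addrC; apply: growth_nnegM; first exact: hG.
apply: growth_nneg_sum => // l; rewrite -[X in growth_nneg _ X]addr0.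
by apply: growth_nnegM; [exact: hF|exact: growth_nneg_cst].
Qed.

End CoordinateGrowth.

(** * Closed form of the exponential in the Sobrero algebra *)

Section SobreroExponential.
Context (R : realType).

Lemma is_derive_linear (a t : R) : is_derive t (1 : R) (fun s => a * s) a.
Proof.
have -> : (fun s => a * s) = a \*: id by [].
by apply: is_derive_eq; rewrite /GRing.scale/= mulr1.
Qed.

Lemma is_derive_expR_linear (a t : R) :
  is_derive t (1 : R) (fun s => expR (a * s)) (a * expR (a * t)).
Proof.
rewrite mulrC.
exact: (@is_derive1_comp _ expR (fun s => a * s) t _ _ _ (is_derive_linear a t)).
Qed.

Lemma is_derive_cos_linear (a t : R) :
  is_derive t (1 : R) (fun s => cos (a * s)) (- sin (a * t) * a).
Proof.
exact: (@is_derive1_comp _ cos (fun s => a * s) t _ _ _ (is_derive_linear a t)).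
Qed.

Lemma is_derive_sin_linear (a t : R) :
  is_derive t (1 : R) (fun s => sin (a * s)) (cos (a * t) * a).
Proof.
exact: (@is_derive1_comp _ sin (fun s => a * s) t _ _ _ (is_derive_linear a t)).
Qed.

Lemma is_derive_negpow (k : nat) (t : R) :
  is_derive t (1 : R) (fun s => (- s) ^+ k / k`!%:R)
    (if k is k'.+1 then - ((- t) ^+ k' / k'`!%:R) else 0).
Proof.
have -> : (fun s : R => (- s) ^+ k / k`!%:R) = (k`!%:R)^-1 \*: (- id) ^+ k.
  by apply/funext => s; rewrite fctE/= mulrC /GRing.scale/= exprfctE.
apply: is_derive_eq.
case: k => [|k]; first by rewrite mul0r scale0r scaler0.
rewrite /GRing.scale/= mulrN1 !mulrN mulrA factS natrM invfM; congr (- _).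
by rewrite [_ * _ * k.+1%:R]mulrAC mulVf// mul1r mulrC.
Qed.

Context (S : falgType R) (m : nat) (X : m.-tuple S).
Context (basisX : basis_of {:S}%VS X) (mulC : forall y z : S, y * z = z * y).

(** This is [exp (- t e)] when [e ^ (n + 1) = 0]. *)
Definition nilpotent_exp (n : nat) (e : S) (t : R) : S :=
  \sum_(k < n.+1) ((- t) ^+ k / k`!%:R) *: e ^+ k.

(** This is [exp (- omega t j)] when [j ^ 2 = - 1]. *)
Definition rotation (j : S) (omega t : R) : S :=
  cos (omega * t) *: 1 + sin (omega * t) *: - j.

Lemma scalar_exp_solves (a : R) : solves X a%:A (fun t => expR (a * t) *: 1).
Proof.
move=> t; apply: cw_derive_eq.
  exact: cw_deriveZ (is_derive_expR_linear a t) (cw_derive_cst X 1 t).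
by rewrite scaler0 add0r -scalerAr mulr1 scalerA mulrC.
Qed.

(** Differentiation shifts the sum by one index, and so does multiplication by
    [- e], up to a top term that contains [e ^ (n + 1)]. *)
Lemma nilpotent_exp_solves n (e : S) : e ^+ n.+1 = 0 ->
  solves X (- e) (nilpotent_exp n e).
Proof.
move=> en t; apply: cw_derive_eq.
  apply: cw_derive_sum => k.
  exact: cw_deriveZ (is_derive_negpow k t) (cw_derive_cst X (e ^+ k) t).
rewrite /nilpotent_exp big_ord_recl/= scaler0 scale0r !add0r.
rewrite big_ord_recr/= mulrDr -scalerAr [- e * e ^+ n]mulNr -exprS en oppr0.
rewrite scaler0 addr0 mulr_sumr; apply: eq_bigr => k _.
by rewrite scaler0 add0r -scalerAr mulNr -exprS scaleNr scalerN.
Qed.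

Lemma rotation_solves (j : S) omega : j ^+ 2 = - 1 ->
  solves X (- (omega *: j)) (rotation j omega).
Proof.
move=> j2 t; apply: cw_derive_eq.
  apply: cw_deriveD.
    exact: cw_deriveZ (is_derive_cos_linear omega t) (cw_derive_cst X 1 t).
  exact: cw_deriveZ (is_derive_sin_linear omega t) (cw_derive_cst X (- j) t).
rewrite !scaler0 !add0r /rotation.
rewrite mulrDr -!scalerAr mulr1 mulrNN -scalerAl -expr2 j2.
by rewrite addrC !scalerN !scalerA mulNr scaleNr.
Qed.

Lemma nilpotent_exp_growth n e b : 0 < b -> cw_growth X (nilpotent_exp n e) b.
Proof.
move=> b0; apply: cw_growth_sum => [|k]; first exact: ltW.
rewrite -[b]addr0; apply: cw_growthZ; last exact: cw_growth_cst.
rewrite -[b]addr0; apply: growth_nnegM; last exact: growth_nneg_cst.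
have [C C0 CK] := growth_nneg_pow k b0; exists C => // t t0.
by rewrite exprNn normrM normrX normrN1 expr1n mul1r CK.
Qed.

Lemma rotation_growth j omega : cw_growth X (rotation j omega) 0.
Proof.
apply: cw_growthD; rewrite -[0 : R](addr0 0); apply: cw_growthZ;
  try exact: cw_growth_cst.
- by apply: (@growth_nneg_bounded _ _ 1) => t; rewrite ler_norml cos_geN1 cos_le1.
- by apply: (@growth_nneg_bounded _ _ 1) => t; rewrite ler_norml sin_geN1 sin_le1.
Qed.

(** The exponential splits along the decomposition of the exponent into its
    real, nilpotent and imaginary parts: the first decays at rate [delta], the
    second is polynomial in [t] and the third is bounded. *)
Lemma sobrero_exp_growth n (j e : S) (delta omega b : R) :
  j ^+ 2 = - 1 -> e ^+ n.+1 = 0 -> - delta < b ->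
  cw_growth X (fun t => cw_exp X (t *: - (delta%:A + e + omega *: j))) b.
Proof.
move=> j2 en db; set x := - _.
pose G t := expR (- delta * t) *: (nilpotent_exp n e t * rotation j omega t).
have G0 : G 0 = 1.
  rewrite /G /nilpotent_exp /rotation !mulr0 expR0 cos0 sin0 !scale1r scale0r addr0.
  rewrite mulr1 big_ord_recl big1 ?addr0 => [|k _].
    by rewrite fact0 expr0 divr1 scale1r.
  by rewrite oppr0 expr0n mul0r scale0r.
have GE : G = fun t => (expR (- delta * t) *: 1) *
    (nilpotent_exp n e t * rotation j omega t).
  by apply/funext => t; rewrite -scalerAl mul1r.
have hG : solves X x G.
  rewrite GE /x !opprD -addrA -scaleNr; apply: (solvesM basisX mulC).
    exact: scalar_exp_solves.
  apply: (solvesM basisX mulC); first exact: nilpotent_exp_solves.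
  exact: rotation_solves.
have -> : (fun t => cw_exp X (t *: x)) = G.
  apply/funext => t; rewrite (solves_unique basisX mulC t (cw_exp_solves basisX x) hG G0).
  by rewrite scale0r cw_exp0// mul1r.
rewrite /G -[b](addrNK (- delta)) addrC.
apply: cw_growthZ; first exact: growth_nneg_expR.
have eta0 : 0 < b - - delta by rewrite subr_gt0.
rewrite -[X in cw_growth _ _ X]addr0; apply: cw_growthM => //; first exact: ltW.
  exact: nilpotent_exp_growth.
exact: rotation_growth.
Qed.

End SobreroExponential.

(** * Integration on the half-line *)

Section HalfLine.
Context (R : realType).
Local Notation mu := (@lebesgue_measure R).

Lemma growth_nneg_integrable (r : R -> R) b : b < 0 -> measurable_fun setT r ->
  growth_nneg r b -> mu.-integrable `[0, +oo[ (EFin \o r).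
Proof.
move=> b0 mr [C C0 rC].
have Nb0 : 0 < - b by rewrite oppr_gt0.
have hpdf := integrable_exponential_pdf Nb0.
have : mu.-integrable `[0, +oo[
    (fun x => (C / - b)%:E * (EFin \o exponential_pdf (- b)) x)%E.
  apply: integrableZl => //.
  by apply: (integrableS measurableT) hpdf.
apply: le_integrable => //.
  by apply/measurable_EFinP; exact: measurable_funTS.
move=> x /=; rewrite in_itv/= andbT => x0.
rewrite exponential_pdfE//= lee_fin mulrA divfK ?gt_eqF// opprK.
by apply: le_trans (rC x x0) _; exact: ler_norm.
Qed.

Lemma growth_nneg_cvg0 (r : R -> R) b : b < 0 -> growth_nneg r b ->
  r n%:R @[n --> \oo] --> 0.
Proof.
move=> b0 [C C0 rC]; apply/norm_cvg0P.
have hC : geometric C (expR b) @ \oo --> 0.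
  by apply: cvg_geometric; rewrite ger0_norm ?expR_ge0// -expR0 ltr_expR.
apply: (squeeze_cvgr _ (cvg_cst 0) hC).
apply: nearW => n; rewrite normr_ge0/=.
by rewrite -expRM_natr; exact: rC.
Qed.

Lemma Rintegral_itv_cvg (f : R -> R) : mu.-integrable `[0, +oo[ (EFin \o f) ->
  (\int[mu]_(t in `[0%R, n%:R]) f t)%R @[n --> \oo] -->
  (\int[mu]_(t in `[0%R, +oo[) f t)%R.
Proof.
move=> fi.
pose f_ (n : nat) := (EFin \o f) \_ (`[0%R, n%:R]%classic : set R).
have mf : measurable_fun (`[0, +oo[%classic : set R) (EFin \o f).
  exact: measurable_int fi.
have sub n : (`[0%R, n%:R]%classic : set R) `<=` `[0, +oo[%classic.
  by move=> x /=; rewrite !in_itv/= andbT => /andP[].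
have mf_ n : measurable_fun (`[0, +oo[%classic : set R) (f_ n).
  rewrite /f_; apply: measurable_funTS; apply/(measurable_restrictT (EFin \o f)) => //.
  exact: (measurable_funS (measurable_itv _) (sub n) mf).
have [||_ _ cf] := @dominated_convergence _ _ R mu _ (measurable_itv _) f_
  (EFin \o f) _ mf_ mf _ (integrable_abse fi) _.
- apply: aeW => x /=; rewrite in_itv/= andbT => x0.
  apply: cvg_near_cst; near=> n.
  rewrite /f_ patchE mem_set//= in_itv/= x0/=.
  by near: n; exact: nbhs_infty_ger.
- apply: aeW => x n _; rewrite /f_ patchE; case: ifP => //= _.
  by rewrite normr0 lee_fin.
apply: fine_cvg; rewrite fineK; last exact: integrable_fin_num.
apply: (cvg_trans _ cf).
apply: near_eq_cvg; apply: nearW => n.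
by rewrite /f_/= -integral_mkcondr setIidr.
Unshelve. all: end_near. Qed.

(** The integrals over [0, N] are [F N - F 0] and converge to the integral over
    the half-line. *)
Lemma Rintegral_derive_halfline (f F : R -> R) :
  mu.-integrable `[0, +oo[ (EFin \o f) ->
  (forall t : R, 0 < t -> is_derive t (1 : R) F (f t)) ->
  F x @[x --> 0^'+] --> F 0 ->
  (forall t : R, 0 < t -> {for t, continuous f}) ->
  f x @[x --> 0^'+] --> f 0 ->
  F n%:R @[n --> \oo] --> 0 ->
  (\int[mu]_(t in `[0%R, +oo[) f t)%R = - F 0.
Proof.
move=> fi dF F0 cf f0 Foo.
have cF (t : R) : 0 < t -> {for t, continuous F}.
  by move=> t0; apply/differentiable_continuous/derivable1_diffP; case: (dF t t0).
suff FTC : (\int[mu]_(t in `[0%R, n%:R]) f t)%R @[n --> \oo] --> - F 0.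
  exact: cvg_unique (Rintegral_itv_cvg fi) FTC.
rewrite -[X in _ --> X]add0r; apply: cvg_trans (cvgB Foo (cvg_cst (F 0))).
apply: near_eq_cvg; exists 1%N => // -[//|n] _ /=.
have n0 : 0 < n.+1%:R :> R by rewrite ltr0n.
rewrite /Rintegral (@continuous_FTC2 _ f F)//.
- apply/continuous_within_itvP => //; split => //.
    by move=> x; rewrite in_itv/= => /andP[x0 _]; exact: cf.
  by apply: cvg_at_left_filter; exact: cf.
- split => //.
    by move=> x; rewrite in_itv/= => /andP[x0 _]; case: (dF x x0).
  by apply: cvg_at_left_filter; exact: cF.
- move=> x; rewrite in_itv/= => /andP[x0 _].
  by rewrite derive1E; case: (dF x x0).
Qed.

Lemma lebesgue_measure_shift (c : R) (A : set R) : measurable A ->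
  pushforward mu (fun x : R => x - c : measurableTypeR R) A = mu A.
Proof.
move=> mA; apply/esym.
have mc : measurable_fun setT (fun x : R => x - c : measurableTypeR R).
  exact: measurable_funB.
apply: (@lebesgue_measure_unique R (pushforward mu (fun x : R => x - c : measurableTypeR R))) => //.
move=> _ [[a b]] _ <-; rewrite /pushforward/=.
rewrite [X in _ = mu X](_ : _ = `]a + c, b + c]%classic); last first.
  by apply/seteqP; split => x /=; rewrite !in_itv/= ltrBrDr lerBlDr.
rewrite !lebesgue_measure_itv/= !lte_fin ltrD2r.
by case: ifP => // _; rewrite -!EFinD opprD addrACA subrr addr0.
Qed.

Lemma ge0_integral_shift (c : R) (f : R -> \bar R) : measurable_fun setT f ->
  (forall x, (0 <= f x)%E) ->
  (\int[mu]_x f (x - c)%R)%E = (\int[mu]_x f x)%E.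
Proof.
move=> mf f0.
have mc : measurable_fun setT (fun x : R => x - c : measurableTypeR R).
  exact: measurable_funB.
have := @ge0_integral_pushforward _ _ (measurableTypeR R) (measurableTypeR R) R _ mc mu setT f measurableT mf.
rewrite preimage_setT => <-; last by move=> *; exact: f0.
by apply/esym/eq_measure_integral => A mA _; exact/esym/lebesgue_measure_shift.
Qed.

(** Translation invariance for nonnegative functions gives integrability of the
    translate, which the signed change of variable needs. *)
Lemma integrable_shift (c : R) (f : R -> R) : mu.-integrable setT (EFin \o f) ->
  mu.-integrable setT (EFin \o (fun x => f (x - c))).
Proof.
move=> /integrableP[mf fi]; apply/integrableP; split.
  apply: (measurableT_comp mf); exact: measurable_funB.
rewrite (ge0_integral_shift c (f := fun x => `|(f x)%:E|%E))//.
exact: measurableT_comp.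
Qed.

Lemma Rintegral_shift (c : R) (f : R -> R) : mu.-integrable setT (EFin \o f) ->
  (\int[mu]_x f (x - c))%R = (\int[mu]_x f x)%R.
Proof.
move=> fi; congr fine.
have mf := measurable_int _ fi.
have mc : measurable_fun setT (fun x : R => x - c : measurableTypeR R).
  exact: measurable_funB.
have := @integral_pushforward _ _ (measurableTypeR R) (measurableTypeR R) R _ mc mu setT (EFin \o f) mf.
rewrite preimage_setT => <- //; last exact: integrable_shift.
by apply/eq_measure_integral => A mA _; exact: lebesgue_measure_shift.
Qed.

Lemma Rintegral_sum n (h : 'I_n -> R -> R) (D : set R) : measurable D ->
  (forall k, mu.-integrable D (EFin \o h k)) ->
  (\int[mu]_(t in D) (\sum_(k < n) h k t))%R =
  \sum_(k < n) (\int[mu]_(t in D) h k t)%R.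
Proof.
move=> mD; elim: n h => [|n IHn] h hi.
  under eq_Rintegral do rewrite big_ord0.
  by rewrite big_ord0 Rintegral_cst// mul0r.
under eq_Rintegral do rewrite big_ord_recl.
rewrite big_ord_recl RintegralD// ?IHn//.
have : mu.-integrable D (fun t => (\sum_(k < n) (h (lift ord0 k) t)%:E)%E).
  by apply: integrable_sum => // k _; exact: hi.
by apply: eq_integrable => // t _; rewrite /= sumEFin.
Qed.

End HalfLine.

Section CoordinateIntegral.
Context (R : realType) (S : falgType R) (m : nat) (X : m.-tuple S).
Context (basisX : basis_of {:S}%VS X).
Local Notation mu := (@lebesgue_measure R).

Lemma cw_integrable_mul (y : S) (D : set R) (F : R -> S) i : measurable D ->
  cw_integrable X D F -> mu.-integrable D (EFin \o (fun t => coord X i (y * F t))).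
Proof.
move=> mD Fi.
have : mu.-integrable D (fun t =>
    (\sum_(k < m) (coord X i (y * X`_k))%:E * (coord X k (F t))%:E)%E).
  by apply: integrable_sum => // k _; apply: integrableZl => //; exact: Fi.
apply: eq_integrable => // t _; rewrite /= coord_mulE// -sumEFin.
by apply: eq_bigr => k _; rewrite -EFinM mulrC.
Qed.

Lemma coord_cw_integral_mul (y : S) (D : set R) (F : R -> S) i : measurable D ->
  cw_integrable X D F ->
  coord X i (y * cw_integral X D F) =
  (\int[mu]_(t in D) coord X i (y * F t))%R.
Proof.
move=> mD Fi; rewrite coord_mulE//.
under [RHS]eq_Rintegral do rewrite coord_mulE//.
rewrite Rintegral_sum// => [|k]; last first.
  have : mu.-integrable D (fun t => (coord X i (y * X`_k))%:E * (coord X k (F t))%:E)%E.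
    by apply: integrableZl => //; exact: Fi.
  by apply: eq_integrable => // t _; rewrite /= -EFinM mulrC.
by apply: eq_bigr => k _; rewrite coord_sumX// RintegralZr//; exact: Fi.
Qed.

Lemma coord_cw_integral (D : set R) (F : R -> S) i :
  coord X i (cw_integral X D F) = (\int[mu]_(t in D) coord X i (F t))%R.
Proof. by rewrite coord_sumX. Qed.

End CoordinateIntegral.

(** * Derivatives on the half-line *)

Section DeriveNneg.
Context (R : realType).

Section OneFunction.
Context (g : R -> R) (dg : derivable_nneg g).

Lemma derive_nneg_cvg (t : R) : 0 <= t ->
  (g (t + h) - g t) / h @[h --> within [set h : R | 0 <= t + h] 0^'] --> derive_nneg g t.
Proof. by move=> t0; rewrite /derive_nneg t0; exact: dg. Qed.

Lemma derive_nneg_right (t : R) : 0 <= t ->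
  (g x - g t) / (x - t) @[x --> t^'+] --> derive_nneg g t.
Proof.
move=> t0 P /(derive_nneg_cvg t0) [e /= e0 eP]; exists e => //= x xe tx.
have := eP (x - t); rewrite /= sub0r normrN distrC => /(_ xe).
rewrite subr_eq0 gt_eqF// => /(_ isT); rewrite addrC subrK; apply.
exact: le_trans (ltW tx).
Qed.

Lemma derive_nneg_is_derive (t : R) : 0 < t -> is_derive t (1 : R) g (derive_nneg g t).
Proof.
move=> t0; have dt : (h^-1 *: ((g \o shift t) (h *: (1 : R)) - g t)) @[h --> (0 : R)^']
    --> derive_nneg g t.
  move=> P /(derive_nneg_cvg (ltW t0)) [e /= e0 eP].
  exists (Num.min e t) => /=; first by rewrite lt_min e0.
  move=> h /=; rewrite sub0r normrN lt_min => /andP[he ht] h0.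
  have := eP h; rewrite /= sub0r normrN => /(_ he h0).
  rewrite /GRing.scale/= mulr1 mulrC (addrC h); apply.
  by rewrite -lerBlDl sub0r; apply: ltW; move: ht; rewrite ltr_norml => /andP[].
by split; [apply/cvg_ex; exists (derive_nneg g t)|exact: cvg_lim].
Qed.

Lemma derive_nneg_continuous (t : R) : 0 < t -> {for t, continuous g}.
Proof.
move=> t0; apply/differentiable_continuous/derivable1_diffP.
by case: (derive_nneg_is_derive t0).
Qed.

Lemma derive_nneg_continuous_right (t : R) : 0 <= t -> g x @[x --> t^'+] --> g t.
Proof.
move=> t0.
have xt : (x - t) @[x --> t^'+] --> (0 : R).
  rewrite -(subrr t); apply: cvgB; last exact: cvg_cst.
  exact: cvg_at_right_filter.
have quot : (g x - g t) / (x - t) * (x - t) + g t @[x --> t^'+] --> g t.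
  rewrite -[X in _ --> X]add0r -(mulr0 (derive_nneg g t)).
  apply: cvgD; last exact: cvg_cst.
  by apply: cvgM => //; exact: derive_nneg_right.
apply: cvg_trans quot; apply: near_eq_cvg; near=> x.
rewrite /= divfK ?subrK// subr_eq0 gt_eqF//.
Unshelve. all: end_near. Qed.

(** A derivative has no jump: by l'Hopital's rule its one-sided limits are
    limits of difference quotients of [g]. *)
Lemma derive_nneg_right_continuous (t : R) : 0 <= t ->
  cvg (derive_nneg g x @[x --> t^'+]) ->
  derive_nneg g x @[x --> t^'+] --> derive_nneg g t.
Proof.
move=> t0 /cvg_ex[l hl]; suff -> : derive_nneg g t = l by [].
have xt : (x - t) @[x --> t^'+] --> (0 : R).
  rewrite -(subrr t); apply: cvgB; last exact: cvg_cst.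
  exact: cvg_at_right_filter.
have t1 : t < t + 1 by rewrite ltrDl.
apply: (cvg_unique _ (derive_nneg_right t0)) => //.
apply: (@lhopital_at_right _ (fun x => g x - g t) (derive_nneg g)
  (fun x => x - t) (fun=> 1) _ _ _ t1) => //.
- move=> x; rewrite in_itv/= => /andP[tx _].
  have := derive_nneg_is_derive (le_lt_trans t0 tx) => ?.
  have -> : (fun x => g x - g t) = g - cst (g t) by [].
  by apply: is_derive_eq; rewrite subr0.
- move=> x _; have -> : (fun x => x - t) = id - cst t by [].
  by apply: is_derive_eq; rewrite subr0.
- by rewrite -(subrr (g t)); apply: cvgB; [|exact: cvg_cst]; exact: derive_nneg_continuous_right.
- by apply: cvg_trans hl; apply: near_eq_cvg; apply: nearW => x; rewrite divr1.
Qed.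

(** The mirror image of the preceding lemma. *)
Lemma derive_nneg_left_continuous (t : R) : 0 < t ->
  cvg (derive_nneg g x @[x --> t^'-]) ->
  derive_nneg g x @[x --> t^'-] --> derive_nneg g t.
Proof.
move=> t0 /cvg_ex[l hl]; suff -> : derive_nneg g t = l by [].
have xt : (x - t) @[x --> t^'-] --> (0 : R).
  rewrite -(subrr t); apply: cvgB; last exact: cvg_cst.
  exact: cvg_at_left_filter.
have quot : (g x - g t) / (x - t) @[x --> t^'-] --> derive_nneg g t.
  move=> P /(derive_nneg_cvg (ltW t0)) [e /= e0 eP].
  exists (Num.min e t) => /=; first by rewrite lt_min e0.
  move=> x /=; rewrite lt_min => /andP[xe xt0] tx.
  have := eP (x - t); rewrite /= sub0r normrN distrC => /(_ xe).
  rewrite subr_eq0 lt_eqF// => /(_ isT); rewrite addrC subrK; apply.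
  by move: xt0; rewrite ltr_norml => /andP[_]; rewrite ltrBlDr ltrDl => /ltW.
apply: (cvg_unique _ quot) => //.
apply: (@lhopital_at_left _ (fun x => g x - g t) (derive_nneg g)
  (fun x => x - t) (fun=> 1) _ _ _ t0) => //.
- move=> x; rewrite in_itv/= => /andP[x0 _].
  have := derive_nneg_is_derive x0 => ?.
  have -> : (fun x => g x - g t) = g - cst (g t) by [].
  by apply: is_derive_eq; rewrite subr0.
- move=> x _; have -> : (fun x => x - t) = id - cst t by [].
  by apply: is_derive_eq; rewrite subr0.
- rewrite -(subrr (g t)); apply: cvgB; last exact: cvg_cst.
  by apply: cvg_at_left_filter; exact: derive_nneg_continuous.
- by apply: cvg_trans hl; apply: near_eq_cvg; apply: nearW => x; rewrite divr1.
Qed.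

End OneFunction.
End DeriveNneg.

(** * The space of originals *)

Section Originals.
Context (R : realType) (d : R).
Local Notation mu := (@lebesgue_measure R).

Lemma Omega_lt_measurable (f : R -> R) : Omega_lt d f -> measurable_fun setT f.
Proof. by case=> [[[]]]. Qed.

Lemma Omega_lt_lt0 (f : R -> R) t : Omega_lt d f -> t < 0 -> f t = 0.
Proof. by case=> [[_ _ + _]] _; exact. Qed.

Lemma Omega_lt_growth (f : R -> R) : Omega_lt d f ->
  exists2 a, a < d & growth_nneg f a.
Proof.
move=> [_ [a ad [M fM]]]; exists a => //; exists `|M| => // t _.
by apply: le_trans (fM t) _; rewrite ler_wpM2r ?expR_ge0// ler_norm.
Qed.

Lemma growth_nneg_exp_growth (f : R -> R) a : (forall t, t < 0 -> f t = 0) ->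
  growth_nneg f a -> exp_growth f a.
Proof.
move=> f0 [C C0 fC]; exists C => t; have [/f0 ->|/fC//] := ltP t 0.
by rewrite normr0 mulr_ge0 ?expR_ge0.
Qed.

Lemma locally_integrableZ (a : R) (f : R -> R) : locally_integrable setT f ->
  locally_integrable setT (fun t => a * f t).
Proof.
move=> [mf oT fi]; split => //; first exact: measurable_funM.
move=> K KT cK; have mK : measurable K by exact: compact_measurable.
under eq_integral do rewrite normrM EFinM.
rewrite ge0_integralZl//; last first.
  by apply/measurable_EFinP; apply: measurableT_comp => //; exact: measurable_funTS.
by apply: lte_mul_pinfty; rewrite ?lee_fin//; exact: fi.
Qed.

Lemma Omega_lt_linear (a b : R) (f g : R -> R) : Omega_lt d f -> Omega_lt d g ->
  Omega_lt d (fun t => a * f t + b * g t).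
Proof.
move=> hf hg.
have [cf cfd fcf] := Omega_lt_growth hf; have [cg cgd gcg] := Omega_lt_growth hg.
have h0 t : t < 0 -> a * f t + b * g t = 0.
  by move=> t0; rewrite (Omega_lt_lt0 hf t0) (Omega_lt_lt0 hg t0) !mulr0 addr0.
have hgr : exp_growth (fun t => a * f t + b * g t) (Num.max cf cg).
  apply: growth_nneg_exp_growth => //.
  have gZ c (h : R -> R) r : growth_nneg h r -> growth_nneg (fun t => c * h t) r.
    by move=> hr; rewrite -[r]add0r; apply: growth_nnegM => //; exact: growth_nneg_cst.
  apply: growth_nnegD; apply: gZ.
    by apply: growth_nnegW fcf; rewrite le_max lexx.
  by apply: growth_nnegW gcg; rewrite le_max lexx orbT.
case: hf => [[lf [ff lrf] _ _] _]; case: hg => [[lg [fg lrg] _ _] _].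
split; last by exists (Num.max cf cg) => //; rewrite gt_max cfd.
split => //; last by exists (Num.max cf cg).
  have := locally_integrableD (locally_integrableZ a lf) (locally_integrableZ b lg).
  exact.
split.
  move=> x y; apply: (@sub_finite_set _ _ ([set t | t \in `[x, y] /\ ~ {for t, continuous f}] `|`
     [set t | t \in `[x, y] /\ ~ {for t, continuous g}])); last by rewrite finite_setU.
  move=> t [txy ct]; apply: contrapT => /not_orP[/not_andP[//|/contrapT ctf]].
  move=> /not_andP[//|/contrapT ctg]; apply: ct.
  by apply: cvgD; apply: cvgM => //; exact: cvg_cst.
move=> t; have [fl fr] := lrf t; have [gl gr] := lrg t.
by split; apply: is_cvgD; apply: is_cvgM => //; exact: is_cvg_cst.
Qed.

Lemma restrict_nneg (h : R -> R) : (forall t, t < 0 -> h t = 0) ->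
  h \_ `[0, +oo[%classic = h.
Proof.
move=> h0; apply/funext => t; rewrite patchE; case: ifPn => // /negP.
by rewrite inE/= in_itv/= andbT => /negP; rewrite -ltNge => /h0.
Qed.

Lemma integrable_nneg (h : R -> R) : (forall t, t < 0 -> h t = 0) ->
  mu.-integrable `[0, +oo[ (EFin \o h) -> mu.-integrable setT (EFin \o h).
Proof.
move=> h0 /integrable_mkcond-/(_ (measurable_itv _)).
by rewrite restrict_EFin restrict_nneg.
Qed.

Lemma Rintegral_nneg (h : R -> R) : (forall t, t < 0 -> h t = 0) ->
  (\int[mu]_(t in `[0%R, +oo[) h t)%R = (\int[mu]_t h t)%R.
Proof. by move=> h0; rewrite Rintegral_mkcond restrict_nneg. Qed.

End Originals.

(** * The Laplace transform *)

Section Laplace.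
Context (R : realType) (n : nat) (S : falgType R) (j e : S).
Context (hS : is_sobrero n j e) (delta omega : R).
Local Notation mu := (@lebesgue_measure R).
Local Notation X := (sobrero_basis n j e).
Local Notation w := (delta%:A + e + omega *: j).
Local Notation E t := (cw_exp X (t *: - w)).
Local Notation L f := (laplace n j e f w).

Lemma laplace_integrandE f t : laplace_integrand n j e f w t = f t *: E t.
Proof. by rewrite /laplace_integrand scalerN. Qed.

Lemma laplace_exp_solves : solves X (- w) (fun t => E t).
Proof. exact: (cw_exp_solves (sobrero_basisP hS)). Qed.

Lemma laplace_exp0 : E 0 = 1.
Proof. by rewrite scale0r (cw_exp0 (sobrero_basisP hS)). Qed.

Lemma laplace_expD s t : E (s + t) = E s * E t.
Proof.
exact: (solvesD (sobrero_basisP hS) (sobrero_mulC hS) s t laplace_exp_solves laplace_exp0).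
Qed.

Lemma laplace_exp_derive i (t : R) :
  is_derive t (1 : R) (fun t : R => coord X i (E t)) (- coord X i (w * E t)).
Proof. by have := laplace_exp_solves t i; rewrite mulNr linearN. Qed.

Lemma laplace_exp_continuous (y : S) i : continuous (fun t : R => coord X i (y * E t)).
Proof.
move=> t; have hD := cw_deriveM (sobrero_basisP hS)
  (cw_derive_cst X y t) (laplace_exp_solves t).
apply/differentiable_continuous/derivable1_diffP.
by case: (hD i).
Qed.

Lemma laplace_exp_coord_continuous i : continuous (fun t : R => coord X i (E t)).
Proof.
have -> : (fun t : R => coord X i (E t)) = (fun t : R => coord X i (1 * E t)).
  by apply/funext => t; rewrite mul1r.
exact: laplace_exp_continuous.
Qed.

Lemma laplace_exp_measurable i : measurable_fun setT (fun t : R => coord X i (E t)).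
Proof.
by apply: continuous_measurable_fun; exact: laplace_exp_coord_continuous.
Qed.

Lemma laplace_exp_growth b i : - delta < b -> growth_nneg (fun t : R => coord X i (E t)) b.
Proof.
move=> db; exact: (sobrero_exp_growth (sobrero_basisP hS) (sobrero_mulC hS) omega
  (sobrero_j2 hS) (sobrero_eps_nilp hS) db i).
Qed.

(** The gap between the growth rate of [f] and [delta] leaves room for the
    polynomial factor in the exponential. *)
Lemma laplace_decay (f : R -> R) a : a < delta -> growth_nneg f a ->
  exists2 b, b < 0 & forall i, growth_nneg (fun t => f t * coord X i (E t)) b.
Proof.
(* The exponential grows at any rate above [- delta]; the opposite of the
   midpoint of [a] and [delta] leaves a negative total rate. *)
move=> ad fa; exists (a + - ((a + delta) / 2)) => [|i].
  by rewrite subr_lt0; have := midf_lt ad => -[].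
apply: growth_nnegM => //; apply: laplace_exp_growth.
by rewrite ltrN2; have := midf_lt ad => -[].
Qed.

Lemma laplace_converges_growth (f : R -> R) a : a < delta ->
  measurable_fun setT f -> growth_nneg f a -> laplace_converges n j e f w.
Proof.
move=> ad mf fa i; have [b b0 hb] := laplace_decay ad fa.
have -> : (fun t => (coord X i (laplace_integrand n j e f w t))%:E) =
          EFin \o (fun t => f t * coord X i (E t)).
  by apply/funext => t; rewrite laplace_integrandE linearZ.
apply: growth_nneg_integrable b0 _ (hb i).
by apply: measurable_funM => //; exact: laplace_exp_measurable.
Qed.

Lemma laplace_converges_Omega (f : R -> R) :
  Omega_lt delta f -> laplace_converges n j e f w.
Proof.
move=> hf; have [a ad fa] := Omega_lt_growth hf.
exact: laplace_converges_growth ad (Omega_lt_measurable hf) fa.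
Qed.

Lemma coord_laplace_mul (y : S) (f : R -> R) i : Omega_lt delta f ->
  coord X i (y * L f) = (\int[mu]_(t in `[0%R, +oo[) (f t * coord X i (y * E t)))%R.
Proof.
move=> hf; rewrite (coord_cw_integral_mul (sobrero_basisP hS) y i (measurable_itv _)
  (laplace_converges_Omega hf)).
by apply: eq_Rintegral => t _; rewrite laplace_integrandE -scalerAr linearZ.
Qed.

Lemma laplace_mul_integrable (y : S) (f : R -> R) i : Omega_lt delta f ->
  mu.-integrable `[0, +oo[ (EFin \o (fun t => f t * coord X i (y * E t))).
Proof.
move=> hf; have := cw_integrable_mul (sobrero_basisP hS) y i (measurable_itv _)
  (laplace_converges_Omega hf).
by apply: eq_integrable => // t _ /=; rewrite laplace_integrandE -scalerAr linearZ.
Qed.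

Lemma coord_laplace (f : R -> R) i :
  coord X i (L f) = (\int[mu]_(t in `[0%R, +oo[) (f t * coord X i (E t)))%R.
Proof.
rewrite (coord_cw_integral (sobrero_basisP hS)).
by apply: eq_Rintegral => t _; rewrite laplace_integrandE linearZ.
Qed.

Lemma laplace_integrable (f : R -> R) i : Omega_lt delta f ->
  mu.-integrable `[0, +oo[ (EFin \o (fun t => f t * coord X i (E t))).
Proof.
move=> hf; have := laplace_mul_integrable 1 i hf.
by apply: eq_integrable => // t _; rewrite /= mul1r.
Qed.

Lemma laplace_linear (a b : R) (f g : R -> R) : Omega_lt delta f -> Omega_lt delta g ->
  L (fun t => a * f t + b * g t) = a *: L f + b *: L g.
Proof.
move=> hf hg; apply: (coord_ext (sobrero_basisP hS)) => i.
rewrite linearD !linearZ/= !coord_laplace.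
have iZ c (h : R -> R) : Omega_lt delta h ->
    mu.-integrable `[0, +oo[ (EFin \o (fun t => c * (h t * coord X i (E t)))).
  move=> hh; have : mu.-integrable `[0, +oo[
      (fun t => c%:E * (h t * coord X i (E t))%:E)%E.
    by apply: integrableZl => //; exact: laplace_integrable.
  exact: eq_integrable.
rewrite -!RintegralZl//; try exact: laplace_integrable.
rewrite -RintegralD//; try exact: iZ.
by apply: eq_Rintegral => t _; rewrite mulrDl !mulrA.
Qed.

(** Integration by parts, as the fundamental theorem of calculus for the
    product of [g] with the exponential, which vanishes at infinity. *)
Lemma laplace_derive (g : R -> R) : derivable_nneg g -> Omega_lt delta g ->
  Omega_lt delta (derive_nneg g) ->
  L (derive_nneg g) = w * L g - (g 0)%:A.
Proof.
move=> dg hg hdg; apply: (coord_ext (sobrero_basisP hS)) => i.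
have [[_ [_ lr] _ _] _] := hdg.
have [a ad ga] := Omega_lt_growth hg; have [b b0 hb] := laplace_decay ad ga.
rewrite linearB linearZ/= coord_laplace coord_laplace_mul//.
apply/eqP; rewrite [X in _ == X]addrC -subr_eq; apply/eqP.
rewrite -RintegralB//; [|exact: laplace_integrable|exact: laplace_mul_integrable].
transitivity (- (g 0 * coord X i (E 0))); last by rewrite laplace_exp0.
apply: (@Rintegral_derive_halfline _ _ (fun t => g t * coord X i (E t))).
- have : mu.-integrable `[0, +oo[ (fun t =>
      (derive_nneg g t * coord X i (E t))%:E - (g t * coord X i (w * E t))%:E)%E.
    by apply: integrableB => //; [exact: laplace_integrable|exact: laplace_mul_integrable].
  exact: eq_integrable.
- move=> t t0; have hgt := derive_nneg_is_derive dg t0.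
  have hEt := laplace_exp_derive i t.
  have -> : (fun t => g t * coord X i (E t)) = g * (fun t : R => coord X i (E t)) by [].
  apply: is_derive_eq; rewrite /GRing.scale/= mulrN addrC; congr (_ - _).
  by rewrite mulrC.
- apply: cvgM; first exact: derive_nneg_continuous_right.
  by apply: cvg_at_right_filter; exact: laplace_exp_coord_continuous.
- move=> t t0; apply: cvgB; apply: cvgM.
  + apply/left_right_continuousP; have [hl hr] := lr t.
    by split; [exact: derive_nneg_left_continuous|
               exact: derive_nneg_right_continuous (ltW t0) hr].
  + exact: laplace_exp_coord_continuous.
  + exact: derive_nneg_continuous.
  + exact: laplace_exp_continuous.
- have [_ hr] := lr 0; apply: cvgB; apply: cvgM.
  + exact: derive_nneg_right_continuous.
  + by apply: cvg_at_right_filter; exact: laplace_exp_coord_continuous.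
  + exact: derive_nneg_continuous_right.
  + by apply: cvg_at_right_filter; exact: laplace_exp_continuous.
- exact: growth_nneg_cvg0 (hb i).
Qed.

Lemma laplace_derivn (k : nat) (f : R -> R) : derivable_nnegn k f ->
  (forall p : nat, (p <= k)%N -> Omega_lt delta (derive_nnegn p f)) ->
  L (derive_nnegn k f) =
    w ^+ k * L f - \sum_(0 <= p < k) w ^+ (k - 1 - p) * (derive_nnegn p f 0)%:A.
Proof.
elim: k => [|k IHk] df hf; first by rewrite big_nil subr0 expr0 mul1r.
have -> : derive_nnegn k.+1 f = derive_nneg (derive_nnegn k f) by [].
rewrite laplace_derive; [|exact: df|exact: hf|exact: (hf k.+1)].
rewrite IHk; last 2 first.
- by move=> p pk; apply: df; exact: ltnW.
- by move=> p pk; apply: hf; exact: leqW.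
have k0 : (k.+1 - 1 - k = 0)%N by rewrite subn1 subnn.
rewrite mulrBr mulrA -exprS big_nat_recr//= k0 expr0 mul1r opprD addrA.
congr (_ - _ - _); rewrite mulr_sumr; apply: eq_big_nat => p /andP[_ pk].
rewrite mulrA -exprS; congr (_ ^+ _ * _).
by case: k pk {IHk df hf k0} => // k pk; rewrite !subn1/= subSn.
Qed.

End Laplace.

(** * Convolution *)

Section Convolution.
Context (R : realType) (n : nat) (S : falgType R) (j e : S).
Context (hS : is_sobrero n j e) (delta omega : R).
Local Notation mu := (@lebesgue_measure R).
Local Notation X := (sobrero_basis n j e).
Local Notation w := (delta%:A + e + omega *: j).
Local Notation E t := (cw_exp X (t *: - w)).
Local Notation L f := (laplace n j e f w).

Context (f g : R -> R) (hf : Omega_lt delta f) (hg : Omega_lt delta g).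

Lemma conv_integrand_eq0 (t tau : R) : tau \notin `[0, t] -> f tau * g (t - tau) = 0.
Proof.
rewrite in_itv/= negb_and -!ltNge => /orP[tau0|ttau].
  by rewrite (Omega_lt_lt0 hf tau0) mul0r.
by rewrite (Omega_lt_lt0 hg) ?mulr0// subr_lt0.
Qed.

Lemma conv_integrand_restrict (t : R) :
  (fun tau => f tau * g (t - tau)) \_ `[0, t]%classic = (fun tau => f tau * g (t - tau)).
Proof.
apply/funext => tau; rewrite patchE; case: ifPn => //.
by rewrite mem_setE => /conv_integrand_eq0 ->.
Qed.

Lemma conv_integrand_measurable (t : R) :
  measurable_fun setT (fun tau => f tau * g (t - tau)).
Proof.
apply: measurable_funM; first exact: Omega_lt_measurable hf.
by apply: (measurableT_comp (Omega_lt_measurable hg)); exact: measurable_funB.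
Qed.

(** With a common growth rate for both factors the bound does not depend on
    the integration variable. *)
Lemma conv_integrand_le : exists2 a, a < delta & exists2 C : R, 0 <= C &
  forall t tau, tau \in `[0, t] -> `|f tau * g (t - tau)| <= C * expR (a * t).
Proof.
have [af afd gf] := Omega_lt_growth hf; have [ag agd gg] := Omega_lt_growth hg.
exists (Num.max af ag); first by rewrite gt_max afd.
have [||C C0 fC] := @growth_nnegW _ f af (Num.max af ag) => //.
  by rewrite le_max lexx.
have [||D D0 gD] := @growth_nnegW _ g ag (Num.max af ag) => //.
  by rewrite le_max lexx orbT.
exists (C * D) => [|t tau]; first exact: mulr_ge0.
rewrite in_itv/= => /andP[tau0 taut]; rewrite normrM.
rewrite -[X in expR (_ * X)](subrKC tau) mulrDr expRD mulrACA.
by apply: ler_pM => //; [exact: fC|apply: gD; rewrite subr_ge0].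
Qed.

Lemma conv_integrand_integrable (t : R) :
  mu.-integrable setT (EFin \o (fun tau => f tau * g (t - tau))).
Proof.
have [a _ [C C0 fgC]] := conv_integrand_le.
suff : mu.-integrable `[0, t] (EFin \o (fun tau => f tau * g (t - tau))).
  move=> /integrable_mkcond-/(_ (measurable_itv _)).
  by rewrite restrict_EFin conv_integrand_restrict.
have hC : mu.-integrable `[0, t] (EFin \o cst (C * expR (a * t))).
  apply: continuous_compact_integrable; first exact: segment_compact.
  by apply: continuous_subspaceT => x; exact: cst_continuous.
move: hC; apply: le_integrable => //.
  by apply/measurable_EFinP; apply: measurable_funTS; exact: conv_integrand_measurable.
by move=> tau /= ttau; rewrite lee_fin; apply: le_trans (ler_norm _); exact: fgC.
Qed.

Lemma convolutionE (t : R) :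
  convolution f g t = (\int[mu]_tau (f tau * g (t - tau)))%R.
Proof. by rewrite /convolution Rintegral_mkcond conv_integrand_restrict. Qed.

Definition conv_kernel i (z : R * R) : R := f z.2 * g (z.1 - z.2) * coord X i (E z.1).

Lemma conv_kernel_measurable i : measurable_fun setT (conv_kernel i).
Proof.
apply: measurable_funM; last first.
  apply: (measurableT_comp (laplace_exp_measurable hS delta omega i)).
  exact: measurable_fst.
apply: measurable_funM.
  by apply: (measurableT_comp (Omega_lt_measurable hf)); exact: measurable_snd.
apply: (measurableT_comp (Omega_lt_measurable hg)).
by apply: measurable_funB; [exact: measurable_fst|exact: measurable_snd].
Qed.

(** The kernel vanishes for [tau] outside [0, t] and is bounded there uniformly
    in [tau], so that integration in [tau] costs only a factor [t]. *)
Lemma conv_kernel_abs_le i : exists2 r : R -> R,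
  mu.-integrable `[0, +oo[ (EFin \o r) &
  forall t, (\int[mu]_tau `|(conv_kernel i (t, tau))%:E| <=
             ((r \_ `[0%R, +oo[%classic) t)%:E)%E.
Proof.
have [a ad [C C0 fgC]] := conv_integrand_le.
exists (fun t => C * (t * (expR (a * t) * `|coord X i (E t)|))).
  have [b b0 hb] := @laplace_decay _ _ _ _ _ hS delta omega _ a ad (growth_nneg_expR a).
  (* The factor [t] has growth rate [- b / 2], half of the available decay. *)
  apply: (@growth_nneg_integrable _ _ (0 + (- b / 2 + b))).
  - by rewrite add0r {2}(splitr b) addrA mulNr addNr add0r ltr_pdivrMr// mul0r.
  - apply: measurable_funM => //; apply: measurable_funM => //.
    apply: measurable_funM.
      apply: measurableT_comp; first exact: measurable_expR.
      by apply: measurable_funM.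
    by apply: measurableT_comp => //; exact: (laplace_exp_measurable hS).
  - apply: growth_nnegM; first exact: growth_nneg_cst.
    apply: growth_nnegM; first by apply: growth_nneg_id; rewrite divr_gt0// oppr_gt0.
    have [D D0 hD] := hb i; exists D => // t t0.
    by rewrite normrM normr_id -normrM; exact: hD.
move=> t; have [t0|t0] := ltP t 0.
  rewrite integral0_eq => [|tau _].
    by rewrite patchE; case: ifPn => //; rewrite mem_setE in_itv/= andbT leNgt t0.
  rewrite /conv_kernel/= conv_integrand_eq0 ?mul0r ?normr0//.
  by rewrite in_itv/=; apply/negP => /andP[/le_trans/[apply]]; rewrite leNgt t0.
rewrite patchE mem_set/=; last by rewrite in_itv/= t0.
have -> : (fun tau => `|(conv_kernel i (t, tau))%:E|%E) =
    (fun tau => `|(conv_kernel i (t, tau))%:E|%E) \_ (`[0, t]%classic : set R).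
  apply/funext => tau; rewrite patchE; case: ifPn => //.
  rewrite mem_setE => /conv_integrand_eq0 h.
  by rewrite /conv_kernel/= h mul0r normr0.
rewrite -integral_mkcond.
have := @integral_le_bound _ _ R mu `[0, t]%classic (fun tau => (conv_kernel i (t, tau))%:E)
  (C * expR (a * t) * `|coord X i (E t)|)%:E (measurable_itv _).
have -> : (C * (t * (expR (a * t) * `|coord X i (E t)|)))%:E =
    ((C * expR (a * t) * `|coord X i (E t)|)%:E * mu `[0%R, t]%classic)%E.
  rewrite lebesgue_measure_itv/= lte_fin.
  have [_|] := ltP 0 t; first by rewrite -EFinD -EFinM subr0 mulrCA mulrC !mulrA.
  by move=> t0'; have -> : t = 0 by [apply/le_anti; rewrite t0 t0']; rewrite mul0r mulr0 mule0.
apply.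
- apply/measurable_EFinP; apply: measurable_funTS.
  exact: (measurable_funM (conv_integrand_measurable t)
    (measurable_cst (coord X i (E t)))).
- by rewrite lee_fin !mulr_ge0 ?expR_ge0.
- apply: aeW => tau /= ttau; rewrite lee_fin normrM.
  by apply: ler_wpM2r => //; exact: fgC.
Qed.

Lemma conv_kernel_integrable i :
  (mu \x mu)%E.-integrable setT (EFin \o conv_kernel i).
Proof.
apply/integrable12ltyP.
  by apply/measurable_EFinP; exact: conv_kernel_measurable.
have [r ri hr] := conv_kernel_abs_le i.
have {}ri : mu.-integrable setT (EFin \o (r \_ `[0%R, +oo[%classic)).
  by move: ri => /integrable_mkcond-/(_ (measurable_itv _)); rewrite restrict_EFin.
apply: le_lt_trans (integrable_lty measurableT ri).
apply: ge0_le_integral => //.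
- by move=> t _; apply: integral_ge0.
- have := @measurable_fun_fubini_tonelli_F _ _ (measurableTypeR R) (measurableTypeR R) R mu
    (fun z => `|(conv_kernel i z)%:E|%E); apply => //.
  apply: measurableT_comp => //; apply/measurable_EFinP; exact: conv_kernel_measurable.
- exact: measurable_int ri.
- by move=> t _; exact: hr.
Qed.

Lemma conv_kernel_integral1 i (t : R) :
  (\int[mu]_tau (conv_kernel i (t, tau))%:E =
   (convolution f g t * coord X i (E t))%:E)%E.
Proof.
rewrite convolutionE -RintegralZr//; last exact: conv_integrand_integrable.
rewrite /Rintegral fineK//; apply: integrable_fin_num => //.
have : mu.-integrable setT (fun tau =>
    (coord X i (E t))%:E * (f tau * g (t - tau))%:E)%E.
  by apply: integrableZl => //; exact: conv_integrand_integrable.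
by apply: eq_integrable => // tau _; rewrite -EFinM mulrC.
Qed.

(** The exponential turns the kernel into a product of a function of [tau]
    and a function of [t - tau]; translation invariance does the rest. *)
Lemma conv_kernel_integral2 i (tau : R) :
  (\int[mu]_t (conv_kernel i (t, tau))%:E =
   (f tau * coord X i (L g * E tau))%:E)%E.
Proof.
pose v s := g s * coord X i (E tau * E s).
have v0 s : s < 0 -> v s = 0 by move=> s0; rewrite /v (Omega_lt_lt0 hg s0) mul0r.
have vi : mu.-integrable setT (EFin \o v).
  by apply: integrable_nneg v0 _; exact: (laplace_mul_integrable hS).
have -> : (fun t => (conv_kernel i (t, tau))%:E) = EFin \o (fun t => f tau * v (t - tau)).
  apply/funext => t /=; rewrite /v -(laplace_expD hS) subrKC mulrA.
  by [].
have vsi := integrable_shift tau vi.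
rewrite -[LHS]fineK; last first.
  apply: integrable_fin_num => //.
  have : mu.-integrable setT (fun t => (f tau)%:E * (v (t - tau))%:E)%E.
    by apply: integrableZl => //; exact: vsi.
  exact: eq_integrable.
congr EFin; rewrite -/(Rintegral _ _ _) RintegralZl//.
rewrite (Rintegral_shift tau vi) (sobrero_mulC hS) (coord_laplace_mul hS)//.
by rewrite Rintegral_nneg.
Qed.

Lemma laplace_convolution_integrable i :
  mu.-integrable setT (EFin \o (fun t => convolution f g t * coord X i (E t))).
Proof.
have := integrable_fubini_F (conv_kernel_integrable i).
by apply: eq_integrable => // t _; rewrite /fubini_F/= conv_kernel_integral1.
Qed.

(** The interval of integration is empty. *)
Lemma convolution_lt0 t : t < 0 -> convolution f g t = 0.
Proof.
move=> t0; rewrite /convolution set_itv_ge ?Rintegral_set0//.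
by rewrite bnd_simp -ltNge.
Qed.

Lemma laplace_convolution_converges : laplace_converges n j e (convolution f g) w.
Proof.
move=> i.
have : mu.-integrable `[0, +oo[ (EFin \o (fun t => convolution f g t * coord X i (E t))).
  by apply: integrableS (laplace_convolution_integrable i).
by apply: eq_integrable => // t _ /=; rewrite laplace_integrandE linearZ.
Qed.

Lemma laplace_convolution : L (convolution f g) = L f * L g.
Proof.
apply: (coord_ext (sobrero_basisP hS)) => i.
rewrite (coord_laplace hS) (sobrero_mulC hS) (coord_laplace_mul hS)//.
rewrite Rintegral_nneg => [|t t0]; last by rewrite convolution_lt0// mul0r.
rewrite Rintegral_nneg => [|t t0]; last by rewrite (Omega_lt_lt0 hf t0) mul0r.
congr fine.
transitivity (\int[mu]_t \int[mu]_tau (conv_kernel i (t, tau))%:E)%E.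
  by apply: eq_integral => t _; rewrite conv_kernel_integral1.
rewrite (Fubini (conv_kernel_integrable i)).
by apply: eq_integral => tau _; rewrite /= conv_kernel_integral2.
Qed.

End Convolution.

Theorem theoremV3p2 (R : realType) (n : nat) (S : falgType R) (j e : S)
    (hS : is_sobrero n j e) (delta omega : R) :
  let w : S := delta%:A + e + omega *: j in
  let L (f : R -> R) : S := laplace n j e f w in
  [/\ (* L is a well-defined linear mapping *)
      (forall f : R -> R, Omega_lt delta f -> laplace_converges n j e f w) /\
      (forall (a b : R) (f g : R -> R), Omega_lt delta f -> Omega_lt delta g ->
         Omega_lt delta (fun t => a * f t + b * g t) /\
         L (fun t => a * f t + b * g t) = a *: L f + b *: L g),
      (* Laplace transform of the derivatives *)
      (forall (k : nat) (f : R -> R), derivable_nnegn k f ->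
         (forall p : nat, (p <= k)%N -> Omega_lt delta (derive_nnegn p f)) ->
         L (derive_nnegn k f) =
           w ^+ k * L f
           - \sum_(0 <= p < k) w ^+ (k - 1 - p) * (derive_nnegn p f 0)%:A) &
      (* Laplace transform of a convolution *)
      (forall f g : R -> R, Omega_lt delta f -> Omega_lt delta g ->
         laplace_converges n j e (convolution f g) w /\
         L (convolution f g) = L f * L g)].
Proof.
move=> w L; split; first split.
- by move=> f hf; exact: (laplace_converges_Omega hS).
- move=> a b f g hf hg; split; first exact: Omega_lt_linear.
  exact: (laplace_linear hS).
- by move=> k f df hf; exact: (laplace_derivn hS).
- move=> f g hf hg; split; first exact: (laplace_convolution_converges hS).
  exact: (laplace_convolution hS).
Qed.
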